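(* Consider the inverse regression model $\mathbf X_i=\boldsymbol\mu+\boldsymbol\Gamma\boldsymbol\beta\mathbf f_i+\sigma\boldsymbol\epsilon_i$, $i=1,\dots,n$, described in the context. In the case $d\le r$, if the errors (the entries of the vectors $\boldsymbol\epsilon_i$) are independent standard normals and the limiting matrix $\boldsymbol\Phi=\lim_{n\to\infty}\boldsymbol\beta(\mathbf F^T\mathbf F)\boldsymbol\beta^T/n$ has distinct eigenvalues, then there exist confidence intervals $$\mathbb P\big(\Theta(\widehat{\boldsymbol\Gamma}_{\mathrm{PFC}},\boldsymbol\Gamma)\ge\Theta^*(\alpha)\big)\le\alpha,$$ where, for any fixed $\alpha$, $\Theta^*(\alpha)=O(1/\sqrt n)$.
   Context: Model. $p,d,r$ are positive integers with $d<p$ and $d\le r$. The parameters are $\boldsymbol\mu\in\mathbb R^p$, a $p\times d$ matrix $\boldsymbol\Gamma$ with $\boldsymbol\Gamma^T\boldsymbol\Gamma=\mathbf I_d$, a $d\times r$ matrix $\boldsymbol\beta$, and the scale factor $\sigma$ of the errors. The $n$ independent observations are $\mathbf X_i=\boldsymbol\mu+\boldsymbol\Gamma\boldsymbol\beta\mathbf f_i+\sigma\boldsymbol\epsilon_i\in\mathbb R^p$, $i=1,\dots,n$. Here $\mathbf f_i\in\mathbb R^r$ is a vector-valued function of the random response, different $i$ corresponding to independent samples of the response, with $\sum_{i=1}^n\mathbf f_i=\mathbf 0$; the error vectors $\boldsymbol\epsilon_i\in\mathbb R^p$ are independent of the responses, and hence of the $\mathbf f_i$. The order $O(1/\sqrt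 n)$ refers to the sample size $n\to\infty$. Matrices. $\mathbb X$ is the $n\times p$ matrix with rows $(\mathbf X_i-\overline{\mathbf X})^T$, $\overline{\mathbf X}=\frac1n\sum_i\mathbf X_i$; $\mathbf F$ is the $n\times r$ matrix with rows $\mathbf f_i^T$, taken to be of full rank. For a full rank matrix $\mathbf G$, $\mathbf P_{\mathbf G}=\mathbf G(\mathbf G^T\mathbf G)^{-1}\mathbf G^T$. The fitted matrix of predictors is $\widehat{\mathbb X}=\mathbf P_{\mathbf F}\mathbb X$. The Frobenius norm is $\|\mathbf A\|_F^2=\operatorname{tr}(\mathbf A^T\mathbf A)$. By the law of large numbers, $\boldsymbol\beta(\mathbf F^T\mathbf F)\boldsymbol\beta^T/n$ converges almost surely to a real symmetric $d\times d$ matrix, denoted $\boldsymbol\Phi$. PFC estimator. $\widehat{\boldsymbol\Gamma}_{\mathrm{PFC}}$ is the $p\times d$ matrix whose columns are (orthogonal) eigenvectors of $\widehat{\mathbb X}^T\widehat{\mathbb X}$ corresponding to its $d$ largest eigenvalues. Their scaling is the one arising from orthogonal transformations $\mathbf V\mathbf O$ of the columns of $\mathbf V=\mathbb X^T\mathbf F(\mathbf F^T\mathbf F)^{-1/2}$, which satisfies $\mathbf V\mathbf V^T=\widehat{\mathbb X}^T\widehat{\mathbb X}$; that is, the column belonging to eigenvalue $\lambda$ has squared Euclidean norm $\lambda$. Angle. $\Theta(\widehat{\boldsymbol\Gamma},\boldsymbol\Gamma)\in[0,\pi/2]$ is defined by $\cot^2\Theta(\widehat{\boldsymbol\Gamma},\boldsymbol\Gamma)=\|\mathbf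 P_{\boldsymbol\Gamma}\widehat{\boldsymbol\Gamma}\|_F^2\,/\,\|(\mathbf I_p-\mathbf P_{\boldsymbol\Gamma})\widehat{\boldsymbol\Gamma}\|_F^2$.
   Formalization: When d = 1 the limiting matrix Φ is additionally assumed nonzero: for d = 1 ''distinct eigenvalues'' is vacuous, and with β = 0, σ = 1 the estimated direction is uniform on the sphere for every n, so the claim fails. *)

(* Defs.v *)
From HB Require Import structures.
From mathcomp Require Import all_boot all_order all_algebra.
From mathcomp Require Import all_classical all_reals all_analysis.

Set Implicit Arguments.
Unset Strict Implicit.
Unset Printing Implicit Defensive.

Import Order.TTheory GRing.Theory Num.Theory.
Import numFieldNormedType.Exports.

Local Open Scope classical_set_scope.
Local Open Scope ring_scope.

Definition sigma_family (T I : Type) d' (S : measurableType d')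
    (X : I -> T -> S) : set (set T) :=
  <<s \bigcup_i preimage_set_system [set: T] (X i) measurable >>.

Definition mutually_independent d (T : measurableType d) (R : realType)
    (P : probability T R) (I : eqType) d' (S : measurableType d')
    (X : I -> T -> S) : Prop :=
  forall (J : seq I) (B : I -> set S), uniq J ->
    (forall i, measurable (B i)) ->
    P (\big[setI/setT]_(i <- J) (X i @^-1` B i)) =
    (\prod_(i <- J) P (X i @^-1` B i))%E.

Definition independent_families d (T : measurableType d) (R : realType)
    (P : probability T R) (I I' : Type) d1 d2 (S : measurableType d1)
    (S' : measurableType d2) (X : I -> T -> S) (X' : I' -> T -> S') : Prop :=
  forall A A' : set T, sigma_family X A -> sigma_family X' A' ->
    P (A `&` A') = (P A * P A')%E.

Section Matrices.
Context {R : realType}.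

Definition colproj {m n : nat} (G : 'M[R]_(m, n)) : 'M[R]_m :=
  G *m invmx (G^T *m G) *m G^T.

Definition frob2 {m n : nat} (A : 'M[R]_(m, n)) : R := \tr (A^T *m A).

(* [angle Gh G] is the number Theta in [0, pi/2] with
   cot^2 Theta = |P_G Gh|^2 / |(I - P_G) Gh|^2, a zero denominator being read
   as cot Theta = +oo; see [angle_itv], [cot2_angle] and [angle_eq0]. The
   undefined case 0/0 (i.e. Gh = 0) gives the worst value pi/2. *)
Definition angle {p d : nat} (Gh G : 'M[R]_(p, d)) : R :=
  let num := frob2 (colproj G *m Gh) in
  let den := frob2 ((1%:M - colproj G) *m Gh) in
  if num == 0 then pi / 2 else atan (Num.sqrt (den / num)).

Definition distinct_eigenvalues {d : nat} (A : 'M[R]_d) : Prop :=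
  exists lam : 'I_d -> R, injective lam /\ forall i, eigenvalue A (lam i).

(* [lam] lists the eigenvalues of [S] in decreasing order, repeated according
   to multiplicity. The columns of [Gh] are pairwise orthogonal, the j-th one
   satisfies S v = lam_j v and has squared norm lam_j (so it vanishes when
   lam_j = 0). *)
Definition top_scaled_eigenvectors {p d : nat} (S : 'M[R]_p)
    (Gh : 'M[R]_(p, d)) : Prop :=
  exists lam : seq R,
    [/\ size lam = p,
        sorted >=%R lam,
        char_poly S = \prod_(x <- lam) ('X - x%:P),
        S *m Gh = Gh *m diag_mx (\row_(j < d) lam`_j) &
        Gh^T *m Gh = diag_mx (\row_(j < d) lam`_j)].

Definition centered_rows {p n : nat} (X : 'I_n -> 'cV[R]_p) : 'M[R]_(n, p) :=
  \matrix_(i < n) (X i - n%:R^-1 *: \sum_(k < n) X k)^T.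

Definition fitted {p r n : nat} (F : 'M[R]_(n, r)) (X : 'M[R]_(n, p)) :
  'M[R]_(n, p) := colproj F *m X.

Definition observation {p d r : nat} (mu : 'cV[R]_p) (Gamma : 'M[R]_(p, d))
    (beta : 'M[R]_(d, r)) (sigma : R) (f : 'cV[R]_r) (e : 'cV[R]_p) :
  'cV[R]_p := mu + Gamma *m beta *m f + sigma *: e.

Definition is_pfc {p d r n : nat} (F : 'M[R]_(n, r)) (X : 'I_n -> 'cV[R]_p)
    (Gh : 'M[R]_(p, d)) : Prop :=
  let Xfit := fitted F (centered_rows X) in
  top_scaled_eigenvectors (Xfit^T *m Xfit) Gh.

End Matrices.

Section Samples.
Context {R : realType} {T Resp : Type} {r p : nat}.

(* The regression function [g n] may depend on the whole response sample
   y_0, ..., y_(n-1); this is what makes the centering sum_i f_i = 0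
   possible. *)
Definition regressor (g : forall n, n.-tuple Resp -> Resp -> 'cV[R]_r)
    (Y : nat -> T -> Resp) (n : nat) (w : T) (i : 'I_n) : 'cV[R]_r :=
  g n [tuple Y k w | k < n] (Y i w).

Definition design (g : forall n, n.-tuple Resp -> Resp -> 'cV[R]_r)
    (Y : nat -> T -> Resp) (n : nat) (w : T) : 'M[R]_(n, r) :=
  \matrix_(i < n) (regressor g Y w i)^T.

Definition error (eps : nat -> 'I_p -> T -> R) (i : nat) (w : T) : 'cV[R]_p :=
  \col_j eps i j w.

End Samples.

Section AngleFacts.
Context {R : realType}.

Lemma frob2_ge0 m n (A : 'M[R]_(m, n)) : 0 <= frob2 A.
Proof.
rewrite /frob2 /mxtrace sumr_ge0// => i _; rewrite mxE sumr_ge0// => j _.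
by rewrite mxE -expr2 sqr_ge0.
Qed.

Lemma angle_itv p d (Gh G : 'M[R]_(p, d)) : 0 <= angle Gh G <= pi / 2.
Proof.
have pi0 : 0 <= pi / 2 :> R by rewrite divr_ge0// pi_ge0.
rewrite /angle; case: ifPn => _; first by rewrite pi0 lexx.
by rewrite (ltW (atan_ltpi2 _)) andbT -[leLHS]atan0 le_atan// sqrtr_ge0.
Qed.

Lemma cot2_angle p d (Gh G : 'M[R]_(p, d)) :
  frob2 ((1%:M - colproj G) *m Gh) != 0 ->
  (cos (angle Gh G) / sin (angle Gh G)) ^+ 2 =
  frob2 (colproj G *m Gh) / frob2 ((1%:M - colproj G) *m Gh).
Proof.
rewrite /angle => den0; case: ifPn => [/eqP ->|num0].
  by rewrite cos_pihalf !mul0r expr0n.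
set t := Num.sqrt _.
have tE : tan (atan t) = t by rewrite atanK.
have -> : cos (atan t) / sin (atan t) = t^-1 by rewrite -{3}tE /tan invf_div.
by rewrite exprVn sqr_sqrtr ?invf_div// divr_ge0// frob2_ge0.
Qed.

Lemma angle_eq0 p d (Gh G : 'M[R]_(p, d)) :
  frob2 ((1%:M - colproj G) *m Gh) = 0 -> frob2 (colproj G *m Gh) != 0 ->
  angle Gh G = 0.
Proof. by rewrite /angle => -> /negbTE ->; rewrite mul0r sqrtr0 atan0. Qed.

End AngleFacts.

(* Main.v *)
(* Write Q = I - P_Gamma, let M be the fitted matrix and W = ||P_F eps||_F^2.
   If the unit vector u_j is the left singular vector of M belonging to the j-th
   estimated direction, that direction is M^T u_j; since M Q = sigma P_F eps Q,
   its component outside the span of Gamma has squared norm at most sigma^2 W,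
   whatever the spectral gaps are. On the other hand the squared norms of the
   directions sum to at least tr(M^T M) / p, which up to a multiple of W exceeds
   a constant times n, because tr(beta F^T F beta^T) / n tends to tr(Phi) > 0.
   Thus tan^2 Theta is at most a constant times W / n once n is large compared
   with W. Finally W is bounded in probability: P_F is independent of eps and has
   trace r, so E W is at most p r times the second moment of an error, and
   Markov's inequality applies. *)

Require Import Defs.
From HB Require Import structures.
From mathcomp Require Import all_boot all_order all_algebra.
From mathcomp Require Import all_classical all_reals all_analysis.
From mathcomp Require Import measurable_realfun ring lra.

Set Implicit Arguments.
Unset Strict Implicit.
Unset Printing Implicit Defensive.

Import Order.TTheory GRing.Theory Num.Theory.
Import numFieldNormedType.Exports.

Local Open Scope classical_set_scope.
Local Open Scope ring_scope.

(** * Frobenius norm and column projections *)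

Section Frobenius.
Context {R : realType}.

Lemma frob2E m n (A : 'M[R]_(m, n)) : frob2 A = \sum_j \sum_i A i j ^+ 2.
Proof.
rewrite /frob2 /mxtrace; apply: eq_bigr => j _; rewrite mxE.
by apply: eq_bigr => i _; rewrite mxE expr2.
Qed.

Lemma frob2_trmx m n (A : 'M[R]_(m, n)) : frob2 A^T = frob2 A.
Proof. by rewrite /frob2 trmxK mxtrace_mulC. Qed.

Lemma frob2Z m n a (A : 'M[R]_(m, n)) : frob2 (a *: A) = a ^+ 2 * frob2 A.
Proof.
rewrite !frob2E mulr_sumr; apply: eq_bigr => j _; rewrite mulr_sumr.
by apply: eq_bigr => i _; rewrite mxE exprMn.
Qed.

Lemma frob2_eq0 m n (A : 'M[R]_(m, n)) : (frob2 A == 0) = (A == 0).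
Proof.
apply/idP/eqP => [|->]; last by rewrite /frob2 mulmx0 mxtrace0.
rewrite frob2E psumr_eq0 => [/allP A0|j _]; last first.
  by apply: sumr_ge0 => i _; exact: sqr_ge0.
apply/matrixP => i j; rewrite mxE.
have := A0 j; rewrite mem_index_enum => /(_ isT) /=.
rewrite psumr_eq0 => [/allP Aj0|k _]; last exact: sqr_ge0.
by have := Aj0 i; rewrite mem_index_enum sqrf_eq0 => /(_ isT) /eqP.
Qed.

Lemma frob2D_le m n (A B : 'M[R]_(m, n)) :
  frob2 (A + B) <= 2 * frob2 A + 2 * frob2 B.
Proof.
rewrite !frob2E !mulr_sumr -big_split/=; apply: ler_sum => j _.
rewrite !mulr_sumr -big_split/=; apply: ler_sum => i _; rewrite mxE.
by rewrite -subr_ge0 (_ : _ - _ = (A i j - B i j) ^+ 2) ?sqr_ge0//; ring.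
Qed.

Lemma frob2_col m n (A : 'M[R]_(m, n)) : frob2 A = \sum_j frob2 (col j A).
Proof.
rewrite frob2E; apply: eq_bigr => j _; rewrite frob2E big_ord1.
by apply: eq_bigr => i _; rewrite mxE.
Qed.

(** The sum of the squares [(x * a i - y * b i) ^+ 2] is nonnegative; at [x = s], [y = p] it equals
    [p * (p * q - s ^+ 2)]. If [p = 0], all [a i] vanish. *)
Lemma cauchy_schwarz_sum (I : finType) (a b : I -> R) :
  (\sum_i a i * b i) ^+ 2 <= (\sum_i a i ^+ 2) * (\sum_i b i ^+ 2).
Proof.
set s := \sum_i a i * b i; set p := \sum_i a i ^+ 2; set q := \sum_i b i ^+ 2.
have p0 : 0 <= p by apply: sumr_ge0 => i _; exact: sqr_ge0.
have key x y : 0 <= x ^+ 2 * p - 2 * x * y * s + y ^+ 2 * q.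
  rewrite /p /q /s !mulr_sumr -sumrN -!big_split/=.
  apply: sumr_ge0 => i _.
  by rewrite (_ : _ + _ = (x * a i - y * b i) ^+ 2) ?sqr_ge0//; ring.
have [pE|p_neq0] := eqVneq p 0; last first.
  have p_gt0 : 0 < p by rewrite lt_neqAle eq_sym p_neq0.
  have := key s p; rewrite (_ : _ + _ = p * (p * q - s ^+ 2)); last by ring.
  by rewrite pmulr_rge0// subr_ge0.
have a0 i : a i = 0.
  move/eqP: pE; rewrite psumr_eq0 => [/allP/(_ i)|k _]; last exact: sqr_ge0.
  by rewrite mem_index_enum sqrf_eq0 => /(_ isT)/eqP.
by rewrite pE mul0r /s big1 ?expr0n// => i _; rewrite a0 mul0r.
Qed.

Lemma frob2_mulmx_le m n k (A : 'M[R]_(m, n)) (B : 'M[R]_(n, k)) :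
  frob2 (A *m B) <= frob2 A * frob2 B.
Proof.
rewrite [frob2 (A *m B)]frob2E [frob2 B]frob2E mulr_sumr.
apply: ler_sum => j _; rewrite -frob2_trmx frob2E mulr_suml.
apply: ler_sum => i _; rewrite mxE.
apply: (le_trans (cauchy_schwarz_sum _ _)); rewrite ler_wpM2r//.
  by apply: sumr_ge0 => l _; exact: sqr_ge0.
by apply: ler_sum => l _; rewrite mxE.
Qed.

(** From [2|xy| <= x^2 + y^2] applied to columns [i] and [j]. Both sides are doubled so that the
    case [i = j] needs no separate treatment. *)
Lemma entry_le_frob2 m n (A : 'M[R]_(m, n)) (i j : 'I_n) :
  `|(A^T *m A) i j| <= frob2 A.
Proof.
have : `|(A^T *m A) i j| *+ 2 <= frob2 A *+ 2; last by rewrite lerMn2r.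
rewrite mxE.
have colE l : \sum_k A k l ^+ 2 <= frob2 A.
  rewrite frob2E (bigD1 l)//= lerDl; apply: sumr_ge0 => k _.
  by apply: sumr_ge0 => o _; exact: sqr_ge0.
apply: (@le_trans _ _ (\sum_k A k i ^+ 2 + \sum_k A k j ^+ 2)); last first.
  by rewrite mulr2n lerD.
apply: (@le_trans _ _ ((\sum_k `|A^T i k * A k j|) *+ 2)).
  by rewrite lerMn2r//= ler_norm_sum.
rewrite -sumrMnl -big_split/=; apply: ler_sum => k _.
rewrite mxE normrM -[A k i ^+ 2]real_normK ?num_real//.
rewrite -[A k j ^+ 2]real_normK ?num_real// -subr_ge0.
by rewrite (_ : _ - _ = (`|A k i| - `|A k j|) ^+ 2) ?sqr_ge0//; ring.
Qed.

(** Pythagoras for an orthogonal projection and its complement. *)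
Lemma frob2_proj n k (Q : 'M[R]_n) (A : 'M[R]_(n, k)) :
  Q^T = Q -> Q *m Q = Q ->
  frob2 A = frob2 (Q *m A) + frob2 ((1%:M - Q) *m A).
Proof.
move=> Qs Qi; have Qi' : (1%:M - Q) *m (1%:M - Q) = 1%:M - Q.
  by rewrite mulmxBr mulmx1 mulmxBl mul1mx Qi subrr subr0.
have Qs' : (1%:M - Q)^T = 1%:M - Q by rewrite linearB/= trmx1 Qs.
rewrite /frob2 -mxtraceD !trmx_mul Qs Qs' !mulmxA -!(mulmxA A^T) Qi Qi'.
by rewrite -mulmxDr -mulmxDl addrC subrK mul1mx.
Qed.

(** A row vector [v] killed by the Gram matrix satisfies [|F v^T|^2 = 0], so it already lies in the
    kernel of [F^T]. *)
Lemma gram_unitmx n r (F : 'M[R]_(n, r)) :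
  (F^T *m F \in unitmx) = (\rank F == r).
Proof.
rewrite -row_free_unit; apply/idP/idP => [|Fr].
  rewrite /row_free => /eqP Hr; rewrite eqn_leq rank_leq_col/=.
  by rewrite -[leqLHS]Hr mxrankM_maxr.
apply/row_freeP; apply: contraPP (Fr) => nG.
have : ~~ row_free (F^T *m F) by apply/negP => /row_freeP.
rewrite -kermx_eq0 => /rowV0Pn[v /sub_kermxP v0 vn0].
have /eqP : frob2 (F *m v^T) = 0.
  by rewrite /frob2 trmx_mul trmxK mulmxA -(mulmxA v) v0 mul0mx mxtrace0.
rewrite frob2_eq0 => /eqP Fv0.
have : row_free F^T by rewrite /row_free mxrank_tr.
rewrite -kermx_eq0 => /eqP kF.
have : (v <= kermx F^T)%MS.
  by apply/sub_kermxP; rewrite -[v]trmxK -trmx_mul Fv0 trmx0.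
by rewrite kF submx0 (negbTE vn0).
Qed.

Section ColumnProjection.
Context {n r : nat} (F : 'M[R]_(n, r)) (Funit : F^T *m F \in unitmx).

Lemma colproj_sym : (colproj F)^T = colproj F.
Proof. by rewrite /colproj !trmx_mul trmx_inv trmx_mul !trmxK mulmxA. Qed.

Lemma colproj_idem : colproj F *m colproj F = colproj F.
Proof.
by rewrite /colproj !mulmxA -[_ *m F^T *m F]mulmxA mulmxKV.
Qed.

Lemma colproj_mul : colproj F *m F = F.
Proof. by rewrite /colproj -!mulmxA mulVmx// mulmx1. Qed.

Lemma colproj_trace : \tr (colproj F) = r%:R.
Proof.
by rewrite /colproj mxtrace_mulC mulmxA mulmxV// mxtrace1.
Qed.

Lemma colproj_frob2 k (A : 'M[R]_(n, k)) :
  frob2 (colproj F *m A) = \tr (A^T *m colproj F *m A).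
Proof.
rewrite /frob2 trmx_mul colproj_sym mulmxA.
by rewrite -(mulmxA A^T _ (colproj F)) colproj_idem.
Qed.

(** An orthogonal projection is its own Gram matrix, and its squared norm is its trace. The bound
    makes the entries integrable when [F] is random. *)
Lemma colproj_entry_le i j : `|colproj F i j| <= r%:R.
Proof.
have := entry_le_frob2 (colproj F) i j.
by rewrite colproj_sym colproj_idem /frob2 colproj_sym colproj_idem colproj_trace.
Qed.

End ColumnProjection.

End Frobenius.

(** * The scaled eigenvectors and the angle *)

Section ScaledEigenvectors.
Context {R : realType}.

(** Compare the coefficients of degree [p - 1] in the two forms of the characteristic polynomial. *)
Lemma mxtrace_roots p (S : 'M[R]_p) (lam : seq R) : (0 < p)%N ->
  size lam = p -> char_poly S = \prod_(x <- lam) ('X - x%:P) ->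
  \tr S = \sum_(x <- lam) x.
Proof.
move=> p0 slam chS; apply: oppr_inj; rewrite -char_poly_trace// chS -slam.
by rewrite coefPn_prod_XsubC// slam -lt0n.
Qed.

(** The first column alone suffices: its squared norm is the largest eigenvalue, which is at least
    the average [\tr S / p]. *)
Lemma top_scaled_eigenvectors_frob2_ge p d (S : 'M[R]_p) (Gh : 'M[R]_(p, d)) :
  (0 < d)%N -> (d < p)%N -> top_scaled_eigenvectors S Gh ->
  \tr S / p%:R <= frob2 Gh.
Proof.
move=> d0 dp [lam [slam sorted_lam chS _ GG]].
have p0 : (0 < p)%N by exact: leq_trans dp.
have lamE j : (Gh^T *m Gh) j j = lam`_j by rewrite GG !mxE eqxx.
have lam0 (j : 'I_d) : 0 <= lam`_j.
  by rewrite -lamE mxE; apply: sumr_ge0 => i _; rewrite mxE -expr2 sqr_ge0.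
rewrite ler_pdivrMr ?ltr0n// (mxtrace_roots p0 slam chS).
have head_le : \sum_(x <- lam) x <= lam`_0 * p%:R.
  rewrite (big_nth 0) slam mulr_natr -[X in _ *+ X]subn0 -sumr_const_nat.
  rewrite !big_mkord; apply: ler_sum => i _.
  apply: (sorted_leq_nth ge_trans ge_refl 0 sorted_lam) => //.
    by rewrite inE slam.
  by rewrite inE slam.
apply: (le_trans head_le); rewrite ler_wpM2r// /frob2 /mxtrace.
under eq_bigr do rewrite lamE.
by rewrite (bigD1 (Ordinal d0))//= lerDl; apply: sumr_ge0.
Qed.

Lemma col_mulmx m n k (A : 'M[R]_(m, n)) (B : 'M[R]_(n, k)) j :
  col j (A *m B) = A *m col j B.
Proof. by rewrite !colE mulmxA. Qed.

(* [Gh_j = M^T u_j] for the left singular vectors [u_j] of [M], so that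
   [Q Gh_j = (M Q)^T u_j]. *)
Lemma top_scaled_eigenvectors_proj_le n p d (M : 'M[R]_(n, p)) (Q : 'M[R]_p)
    (Gh : 'M[R]_(p, d)) : Q^T = Q ->
  top_scaled_eigenvectors (M^T *m M) Gh ->
  frob2 (Q *m Gh) <= d%:R * frob2 (M *m Q).
Proof.
move=> Qs [lam [slam sorted_lam chS SG GG]].
rewrite frob2_col mulr_natl -[X in _ *+ X]card_ord -sumr_const.
apply: ler_sum => j _; rewrite col_mulmx; set v := col j Gh.
have vv : frob2 v = lam`_j.
  by rewrite /frob2 /v tr_col -row_mul /mxtrace big_ord1 -col_mulmx GG !mxE eqxx.
have Sv : M^T *m M *m v = lam`_j *: v.
  rewrite /v -col_mulmx SG; apply/colP => i; rewrite !mxE.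
  rewrite (bigD1 j)//= big1 ?addr0 => [|k kj]; rewrite !mxE ?eqxx ?mulr1n 1?mulrC//.
  by rewrite (negbTE kj) mulr0n mul0r.
have Mv : frob2 (M *m v) = lam`_j ^+ 2.
  rewrite /frob2 trmx_mul -mulmxA (mulmxA M^T) Sv -scalemxAr mxtraceZ.
  by rewrite -/(frob2 v) vv expr2.
have [l0|ln0] := eqVneq (lam`_j) 0.
  move: vv; rewrite l0 => /eqP; rewrite frob2_eq0 => /eqP ->.
  by rewrite mulmx0 /frob2 mulmx0 mxtrace0 frob2_ge0.
(* Here [lam_j Q v = (M Q)^T (M v)] and [|M v|^2 = lam_j^2], so the eigenvalue cancels and no
   spectral gap enters. *)
have : lam`_j ^+ 2 * frob2 (Q *m v) <= lam`_j ^+ 2 * frob2 (M *m Q).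
  rewrite -frob2Z scalemxAr -Sv !mulmxA -[leRHS]mulrC -Mv -(frob2_trmx (M *m Q)).
  by rewrite trmx_mul Qs -mulmxA frob2_mulmx_le.
by rewrite ler_pM2l// exprn_even_gt0.
Qed.

End ScaledEigenvectors.

(** * Bound on the angle for a fixed design and fixed errors *)

Section DeterministicBound.
Context {R : realType}.

(** Mean value theorem: the derivative [1 / (1 + y^2)] is at most 1. *)
Lemma atan_le (x : R) : 0 <= x -> atan x <= x.
Proof.
move=> x0; have [|c _] := @MVT_segment R atan (fun y => (1 + y ^+ 2)^-1) 0 x x0.
  by apply: continuous_subspaceT; exact: continuous_atan.
rewrite atan0 !subr0 => ->; rewrite ler_piMl// invf_le1 ?ltr_wpDr ?sqr_ge0//.
by rewrite lerDl sqr_ge0.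
Qed.

Lemma angle_le p d (Gh G : 'M[R]_(p, d)) (a b : R) : 0 < b ->
  b <= frob2 (colproj G *m Gh) -> frob2 ((1%:M - colproj G) *m Gh) <= a ->
  angle Gh G <= Num.sqrt (a / b).
Proof.
move=> b0 bnum dena.
have num0 : 0 < frob2 (colproj G *m Gh) by exact: lt_le_trans bnum.
rewrite /angle gt_eqF//; apply: (le_trans (atan_le (sqrtr_ge0 _))).
have a0 : 0 <= a by apply: le_trans dena; exact: frob2_ge0.
rewrite ler_wsqrtr//.
by apply: ler_pM; rewrite ?frob2_ge0 ?invr_ge0 ?(ltW num0)// lef_pV2 ?posrE.
Qed.

Context {n p d r : nat} (F : 'M[R]_(n, r)) (Gamma : 'M[R]_(p, d)).
Hypothesis Gamma_orth : Gamma^T *m Gamma = 1%:M.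

Lemma colproj_orth : colproj Gamma = Gamma *m Gamma^T.
Proof. by rewrite /colproj Gamma_orth invmx1 mulmx1. Qed.

Lemma orth_gram_unitmx : Gamma^T *m Gamma \in unitmx.
Proof. by rewrite Gamma_orth unitmx1. Qed.

(** [K] bounds the energy of the projected errors and [tau] is a lower bound for the signal energy.
    The lemma applies once [tau] dominates the noise, and is later used with [tau] proportional to
    the sample size. *)
Lemma pfc_angle_le (beta : 'M[R]_(d, r)) (sigma : R) (E M : 'M[R]_(n, p))
    (Gh : 'M[R]_(p, d)) (tau K : R) : (0 < d)%N -> (d < p)%N ->
  M = F *m (beta^T *m Gamma^T) + sigma *: (colproj F *m E) ->
  top_scaled_eigenvectors (M^T *m M) Gh ->
  frob2 (colproj F *m E) <= K ->
  8 * p%:R * (1 + d%:R) * (sigma ^+ 2 * K) <= tau ->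
  0 < tau ->
  tau <= \tr (beta *m (F^T *m F) *m beta^T) ->
  angle Gh Gamma <= Num.sqrt (4 * p%:R * d%:R * (sigma ^+ 2 * K) / tau).
Proof.
move=> d0 dp ME top WK Ktau tau0 taus.
set Q := 1%:M - colproj Gamma.
have Qs : Q^T = Q by rewrite /Q linearB/= trmx1 colproj_sym.
have FE : frob2 (F *m (beta^T *m Gamma^T)) = \tr (beta *m (F^T *m F) *m beta^T).
  rewrite -frob2_trmx /frob2 trmxK !trmx_mul !trmxK !mulmxA.
  rewrite -(mulmxA _ Gamma^T Gamma) Gamma_orth mulmx1.
  by rewrite -(mulmxA (F *m beta^T)) mxtrace_mulC !mulmxA.
have K0 : 0 <= sigma ^+ 2 * K.
  by rewrite mulr_ge0 ?sqr_ge0//; apply: le_trans WK; exact: frob2_ge0.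
have sWK : frob2 (sigma *: (colproj F *m E)) <= sigma ^+ 2 * K.
  by rewrite frob2Z ler_wpM2l// sqr_ge0.
have p0 : (0 < p)%N by exact: leq_trans dp.
have GQ : Gamma^T *m Q = 0.
  by rewrite /Q mulmxBr mulmx1 colproj_orth mulmxA Gamma_orth mul1mx subrr.
have MQ : M *m Q = sigma *: (colproj F *m E) *m Q.
  by rewrite ME mulmxDl -2!mulmxA GQ !mulmx0 add0r.
have den : frob2 (Q *m Gh) <= d%:R * (sigma ^+ 2 * K).
  apply: (le_trans (top_scaled_eigenvectors_proj_le Qs top)).
  rewrite ler_wpM2l//; apply: le_trans sWK; rewrite MQ -frob2_trmx trmx_mul Qs.
  rewrite -[leRHS]frob2_trmx.
  rewrite [leRHS](frob2_proj _ (colproj_sym Gamma) (colproj_idem orth_gram_unitmx)).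
  by rewrite lerDr frob2_ge0.
have sM : \tr (beta *m (F^T *m F) *m beta^T) <=
    2 * \tr (M^T *m M) + 2 * (sigma ^+ 2 * K).
  rewrite -FE (_ : F *m _ = M + (- sigma) *: (colproj F *m E)).
    apply: (le_trans (frob2D_le _ _)); rewrite lerD2l ler_wpM2l//.
    by rewrite frob2Z sqrrN -frob2Z.
  by rewrite ME scaleNr addrK.
have tot := top_scaled_eigenvectors_frob2_ge d0 dp top.
have split := frob2_proj Gh (colproj_sym Gamma) (colproj_idem orth_gram_unitmx).
(* In the notation below, [t <= (z + q) * P], [tau / 2 - x <= t] and [q <= D * x]. Hence [z * P] is
   at least [tau / 2 - x - D * x * P], and the assumption on [tau] bounds the subtracted terms by
   [tau / 8]. *)
have : tau / (4 * p%:R) <= frob2 (colproj Gamma *m Gh).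
  rewrite ler_pdivrMr ?mulr_gt0 ?ltr0n//.
  move: tot; rewrite ler_pdivrMr ?ltr0n// split -/Q => tot.
  have p1 : 1 <= p%:R :> R by rewrite ler1n.
  have dd : 0 <= d%:R :> R by [].
  move: den K0 sM taus Ktau tot.
  set x := sigma ^+ 2 * K; set q := frob2 (Q *m Gh); set z := frob2 _.
  set t := \tr (M^T *m M); set P := p%:R; set D := d%:R.
  move: (\tr (beta *m _ *m _)) => s den K0 sM taus Ktau tot.
  have h1 : q * P <= D * x * P by rewrite ler_wpM2r// ltW// (lt_le_trans _ p1).
  have h2 : x <= P * x by rewrite ler_peMl.
  nra.
move=> num; apply: (le_trans (angle_le _ num den)).
  by rewrite divr_gt0// mulr_gt0// ltr0n.
rewrite ler_wsqrtr// le_eqVlt; apply/orP; left; apply/eqP; field.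
by rewrite ?pnatr_eq0 -?lt0n p0 andbT gt_eqF.
Qed.

End DeterministicBound.

(** * Signal and noise in the fitted matrix *)

Section FittedMatrix.
Context {R : realType}.

Lemma centered_rowsE n p (X : 'I_n -> 'cV[R]_p) :
  centered_rows X = \matrix_(i < n) (X i)^T -
    const_mx 1 *m (n%:R^-1 *: \sum_(k < n) X k)^T.
Proof.
by apply/matrixP => i j; rewrite !mxE big_ord1 !mxE mul1r.
Qed.

(** Since the [f i] sum to zero, the constant vector is orthogonal to the columns of [F]. The
    projection therefore kills both [mu] and the sample mean, while it fixes the signal. *)
Lemma fitted_observation n p d r (mu : 'cV[R]_p) (Gamma : 'M[R]_(p, d))
    (beta : 'M[R]_(d, r)) (sigma : R) (f : 'I_n -> 'cV[R]_r)
    (e : 'I_n -> 'cV[R]_p) (F := \matrix_(i < n) (f i)^T) :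
  \sum_i f i = 0 -> F^T *m F \in unitmx ->
  fitted F (centered_rows (fun i => observation mu Gamma beta sigma (f i) (e i))) =
  F *m (beta^T *m Gamma^T) + sigma *: (colproj F *m \matrix_(i < n) (e i)^T).
Proof.
move=> f0 Funit.
have F1 : colproj F *m const_mx 1 = 0 :> 'cV_n.
  suff FT1 : F^T *m const_mx 1 = 0 :> 'cV_r by rewrite -mulmxA FT1 mulmx0.
  apply/colP => k; have /colP/(_ k) := f0; rewrite summxE !mxE => fk0.
  rewrite -[RHS]fk0; apply: eq_bigr => i _.
  by rewrite !mxE mulr1.
rewrite /fitted centered_rowsE mulmxBr (mulmxA _ (const_mx 1)) F1 mul0mx subr0.
have -> : \matrix_(i < n) (observation mu Gamma beta sigma (f i) (e i))^T =
    const_mx 1 *m mu^T + F *m (beta^T *m Gamma^T) +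
    sigma *: \matrix_(i < n) (e i)^T.
  apply/matrixP => i j; rewrite -trmx_mul !mxE big_ord1 !mxE mul1r.
  congr (_ + _ + _); apply: eq_bigr => k _; rewrite [RHS]mulrC !mxE.
  by congr (_ * _); rewrite mxE.
rewrite !mulmxDr (mulmxA _ (const_mx 1)) F1 mul0mx add0r (mulmxA _ F) colproj_mul//.
by rewrite -scalemxAr.
Qed.

End FittedMatrix.

(** * Positivity of the trace of the limit matrix *)

Section LimitTrace.
Context {R : realType}.

(** The only possible eigenvalue of the zero matrix is 0, which two indices would have to share. For
    [d = 1] the zero matrix does have distinct eigenvalues. *)
Lemma distinct_eigenvalues_neq0 d (A : 'M[R]_d) : (1 < d)%N ->
  distinct_eigenvalues A -> A != 0.
Proof.
move=> d1 [lam [injlam eiglam]]; apply/eqP => A0.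
have lam0 i : lam i = 0.
  have /eigenvalueP[v] := eiglam i; rewrite A0 mulmx0 => /esym/eqP.
  by rewrite scaler_eq0 => /orP[/eqP|->//].
have : Ordinal (ltnW d1) = Ordinal d1 by apply: injlam; rewrite !lam0.
by move=> /(congr1 val).
Qed.

Lemma cvg_mx_entry d (A : nat -> 'M[R]_d) (Phi : 'M[R]_d) i j :
  A @ \oo --> Phi -> (fun k => A k i j) @ \oo --> Phi i j.
Proof.
by move=> cvgA; exact: (cvg_comp _ (fun M : 'M[R]_d => M i j) cvgA
  (@coord_continuous _ _ _ _ _ Phi)).
Qed.

Lemma cvg_mxtrace d (A : nat -> 'M[R]_d) (Phi : 'M[R]_d) :
  A @ \oo --> Phi -> (fun k => \tr (A k)) @ \oo --> \tr Phi.
Proof.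
move=> cvgA; apply: (cvg_big (op := +%R)) => [|i _]; first exact: add_continuous.
exact: cvg_mx_entry.
Qed.

(** Every entry of a Gram matrix is bounded by its trace, and this survives in the limit; a nonzero
    entry of [Phi] then makes the trace positive. *)
Lemma gram_limit_trace_gt0 d (n : nat -> nat) (A : forall k, 'M[R]_(n k, d))
    (c : nat -> R) (Phi : 'M[R]_d) : (forall k, 0 <= c k) ->
  (fun k => c k *: ((A k)^T *m A k)) @ \oo --> Phi -> Phi != 0 -> 0 < \tr Phi.
Proof.
move=> c0 cvgA Phi0.
have entry_le i j : `|Phi i j| <= \tr Phi.
  have cvg_ij : (fun k => (c k *: ((A k)^T *m A k)) i j) @ \oo --> Phi i j.
    exact: (cvg_mx_entry cvgA).
  have cvg_tr : (fun k => \tr (c k *: ((A k)^T *m A k))) @ \oo --> \tr Phi.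
    exact: (cvg_mxtrace cvgA).
  apply: (ler_cvg_to (cvg_norm cvg_ij) cvg_tr).
  apply: nearW => k; rewrite mxtraceZ mxE normrM ger0_norm//.
  by rewrite ler_wpM2l// entry_le_frob2.
have [i [j ij]] : exists i j, Phi i j != 0.
  apply: contrapT => H; move/negP: Phi0; apply; apply/eqP/matrixP => i j.
  rewrite mxE; apply/eqP; apply: contrapT => /negP Pij; apply: H.
  by exists i, j.
by apply: lt_le_trans (entry_le i j); rewrite normr_gt0.
Qed.

End LimitTrace.

(** * Means of products of independent variables *)

Section IndependentProduct.
Local Open Scope ereal_scope.
Context d (T : measurableType d) (R : realType) (P : probability T R).

(** The two measures agree on rectangles, which determine the product measure. *)
Lemma indep_pushforwardE (U V : {RV P >-> R}) (W : {RV P >-> (R * R)%type}) :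
  (forall w, W w = (U w, V w)) ->
  (forall A B : set R, measurable A -> measurable B ->
    P (U @^-1` A `&` V @^-1` B) = P (U @^-1` A) * P (V @^-1` B)) ->
  forall X, measurable X ->
    distribution P W X = (distribution P U \x distribution P V) X.
Proof.
move=> WE UV X mX; apply/esym/product_measure_unique => // A B mA mB.
rewrite -UV//; congr (P _); apply/seteqP.
by split=> w /=; rewrite WE.
Qed.

(** The joint law is the product of the marginal laws, so the claim becomes Fubini's theorem for
    [x * y] on the plane. *)
Lemma indep_integralM (u v : T -> R) :
  P.-integrable setT (EFin \o u) -> P.-integrable setT (EFin \o v) ->
  (forall A B : set R, measurable A -> measurable B ->
    P (u @^-1` A `&` v @^-1` B) = P (u @^-1` A) * P (v @^-1` B)) ->
  P.-integrable setT (fun w => (u w * v w)%:E) /\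
  \int[P]_w (u w * v w)%:E = (\int[P]_w (u w)%:E) * (\int[P]_w (v w)%:E).
Proof.
move=> iu iv uv.
have mu : measurable_fun setT u by exact/measurable_EFinP/(measurable_int P).
have mv : measurable_fun setT v by exact/measurable_EFinP/(measurable_int P).
pose U : {RV P >-> R} := mfun_Sub (mem_set mu).
pose V : {RV P >-> R} := mfun_Sub (mem_set mv).
have mw : measurable_fun setT (fun w => (u w, v w)) by exact: measurable_fun_pair.
pose W : {RV P >-> (R * R)%type} := mfun_Sub (mem_set mw).
have WE := @indep_pushforwardE U V W (fun=> erefl) uv.
have mxy : measurable_fun setT (fun z : R * R => (z.1 * z.2)%:E).
  by apply/measurable_EFinP; exact: measurable_funM.
have absE (t : T -> R) (mt : measurable_fun setT t) (X : {RV P >-> R}) :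
    (X : T -> R) = t ->
    \int[distribution P X]_x `|x%:E| = \int[P]_w `|(t w)%:E|.
  move=> <-; rewrite ge0_integral_distribution//.
  by apply: measurableT_comp => //; exact/measurable_EFinP.
have fin_abs (t : T -> R) : P.-integrable setT (EFin \o t) ->
    \int[P]_w `|(t w)%:E| \is a fin_num.
  by move=> it; exact: (integrable_fin_num measurableT (integrable_abse it)).
(* Tonelli: the iterated integral of [|x| |y|] factors into the two finite absolute moments. *)
have ixy : (distribution P U \x distribution P V).-integrable setT
    (fun z : R * R => (z.1 * z.2)%:E).
  apply/integrable12ltyP => //.
  rewrite (_ : integral _ _ _ =
      \int[distribution P U]_x \int[distribution P V]_y (`|x%:E| * `|y%:E|)).
  under eq_integral => x _.
    rewrite ge0_integralZl//; last by apply: measurableT_comp => //; exact/measurable_EFinP.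
    over.
    rewrite (absE v)// ge0_integralZr//; last 2 first.
      by apply: measurableT_comp => //; exact/measurable_EFinP.
      exact: integral_ge0.
    rewrite (absE u)// -[X in X * _]fineK ?fin_abs// -[X in _ * X]fineK ?fin_abs//.
    by rewrite -EFinM ltry.
  by apply: eq_integral => x _; apply: eq_integral => y _; rewrite EFinM abseM.
have iW : P.-integrable setT ((fun z : R * R => (z.1 * z.2)%:E) \o W).
  apply/integrableP; split; first exact: measurableT_comp.
  rewrite -(@ge0_integral_distribution _ _ _ _ _ P W
    (abse \o (fun z => (z.1 * z.2)%:E)))//; last 2 first.
    exact: measurableT_comp.
    by move=> z; exact: abse_ge0.
  rewrite (eq_measure_integral _ (fun A mA _ => WE A mA)).
  by have /integrableP[] := ixy.
split=> //.
rewrite -[LHS]/(\int[P]_w ((fun z : R * R => (z.1 * z.2)%:E) \o W) w).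
rewrite -integral_distribution//.
rewrite (eq_measure_integral _ (fun A mA _ => WE A mA)).
rewrite -integral12_prod_meas1//.
have iid (t : T -> R) (it : P.-integrable setT (EFin \o t)) (X : {RV P >-> R}) :
    (X : T -> R) = t ->
    (distribution P X).-integrable setT EFin /\
    \int[distribution P X]_x x%:E = \int[P]_w (t w)%:E.
  move=> tE; rewrite -tE in it *; split.
    exact: integrable_pushforward.
  by rewrite integral_distribution.
have [iV EV] := iid v iv V erefl.
have [iU EU] := iid u iu U erefl.
under eq_integral => x _.
  rewrite /fubini_F/=; under eq_integral do rewrite /= EFinM.
  rewrite integralZl// EV; over.
have fv : \int[P]_w (v w)%:E \is a fin_num by exact: (integrable_fin_num measurableT iv).
by rewrite -(fineK fv) integralZr// EU.
Qed.

(** Integrability travels with the value, so that means can be added and multiplied as real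
    numbers. *)
Definition has_mean (f : T -> R) (m : R) :=
  P.-integrable setT (EFin \o f) /\ \int[P]_w (f w)%:E = m%:E.

Lemma integrable_has_mean (f : T -> R) : P.-integrable setT (EFin \o f) ->
  has_mean f (fine (\int[P]_w (f w)%:E)).
Proof.
by move=> intf; split=> //; rewrite fineK// (integrable_fin_num measurableT).
Qed.

Lemma has_mean_indepM (u v : T -> R) (a b : R) :
  has_mean u a -> has_mean v b ->
  (forall A B : set R, measurable A -> measurable B ->
    P (u @^-1` A `&` v @^-1` B) = P (u @^-1` A) * P (v @^-1` B)) ->
  has_mean (fun w => u w * v w)%R (a * b)%R.
Proof.
move=> [iu Eu] [iv Ev] uv; have [iuv Euv] := indep_integralM iu iv uv.
by split=> //; rewrite Euv Eu Ev EFinM.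
Qed.

Lemma has_mean_sum (I : finType) (f : I -> T -> R) (m : I -> R) :
  (forall i, has_mean (f i) (m i)) ->
  has_mean (fun w => \sum_i f i w)%R (\sum_i m i)%R.
Proof.
move=> fm; split.
  rewrite (_ : _ \o _ = (fun w => \sum_i (EFin \o f i) w)).
    by apply: integrable_sum => // i _; exact: (fm i).1.
  by apply/funext => w /=; rewrite sumEFin.
under eq_integral do rewrite -sumEFin.
rewrite integral_sum//; last by move=> i; exact: (fm i).1.
by rewrite -sumEFin; apply: eq_bigr => i _; exact: (fm i).2.
Qed.

Lemma has_mean_le (f : T -> R) (m c : R) : has_mean f m ->
  (forall w, f w <= c)%R -> (m <= c)%R.
Proof.
move=> [intf Ef] fc; rewrite -lee_fin -Ef.
rewrite -[leRHS]mule1 -(probability_setT P) -integral_cst//.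
apply: le_integral => //; first exact: finite_measure_integrable_cst.
by move=> w _; rewrite lee_fin.
Qed.

Lemma has_mean_markov (f : T -> R) (m c : R) : has_mean f m ->
  (forall w, 0 <= f w)%R -> (0 < c)%R ->
  P [set w | c <= f w]%R <= (m / c)%:E.
Proof.
move=> [intf Ef] f0 c0; rewrite EFinM -Ef lee_pdivlMr// muleC.
have := @le_integral_comp_abse _ _ _ P _ measurableT (EFin \o f) c id.
rewrite setTI (_ : [set x | _] = [set w | c <= f w]%R); last first.
  by apply/seteqP; split=> w /=; rewrite lee_fin ger0_norm.
rewrite (eq_integral (EFin \o f)); last by move=> w _; rewrite /= ger0_norm.
by apply => //; exact: measurable_int intf.
Qed.

End IndependentProduct.

(** * Moments of the normal distribution *)

Section NormalMoments.
Local Open Scope ereal_scope.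
Context {R : realType}.
Local Notation mu := (@lebesgue_measure R).

(** The Radon-Nikodym derivative of the normal law agrees almost everywhere with its density, since
    both have the same integral over every measurable set. *)
Lemma ge0_integral_normal_prob (m s : R) (f : R -> \bar R) :
  (forall x, 0 <= f x) -> measurable_fun setT f ->
  \int[normal_prob m s]_x f x = \int[mu]_x (f x * (normal_pdf m s x)%:E).
Proof.
move=> f0 mf.
have dom := @normal_prob_dominates R m s.
rewrite -(Radon_Nikodym_SigmaFinite.change_of_variables dom)//.
have mpdf : measurable_fun setT (fun x => (normal_pdf m s x)%:E).
  by apply/measurable_EFinP; exact: measurable_normal_pdf.
have iRN := Radon_Nikodym_SigmaFinite.f_integrable dom.
apply: ae_eq_integral => //.
- by apply: emeasurable_funM => //; exact: measurable_int iRN.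
- exact: emeasurable_funM.
- apply: ae_eqe_mul2l.
  apply: integral_ae_eq => // E _ mE.
  by rewrite -Radon_Nikodym_SigmaFinite.f_integral.
Qed.

Lemma normal_pdfN (s x : R) : s != 0%R ->
  normal_pdf 0 s (- x) = normal_pdf 0 s x.
Proof. by move=> s0; rewrite !normal_pdfE// /normal_fun !subr0 sqrrN. Qed.

(** As [G] vanishes on the positive axis, the two integrals live on opposite half-lines, which the
    substitution [x -> -x] exchanges. *)
Lemma integral_halfline_opp (G : R -> R) : continuous G ->
  (forall x, (0 <= G x)%R) -> (forall x, (0 < x)%R -> G x = 0%R) ->
  \int[mu]_x (G x)%:E = \int[mu]_x (G (- x)%R)%:E.
Proof.
move=> cG G0 Gpos.
have := @ge0_integration_by_substitutionNy R G 0%R.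
rewrite oppr0 [X in _ -> _ -> X = _]integral_mkcond.
rewrite [X in _ -> _ -> _ = X]integral_mkcond => H.
transitivity (\int[mu]_x ((EFin \o G) \_ `]-oo, 0%R]) x).
  apply: eq_integral => x _; rewrite patchE; case: ifPn => //.
  by rewrite notin_setE /= in_itv/= => /negP; rewrite -ltNge => /Gpos ->.
rewrite H//; last exact: continuous_subspaceT.
apply: eq_integral => x _; rewrite patchE; case: ifPn => //.
rewrite notin_setE /= in_itv/= andbT => /negP; rewrite -ltNge => x0.
by rewrite Gpos// oppr_gt0.
Qed.

(** Write [exp(-x^2/2) = exp(-x^2/8) exp(-3x^2/8)] and use [x^2 <= 3 exp(3x^2/8)], from
    [1 + y <= exp y]. The peaks differ by a factor 2, whence 6. The second moment is thus dominated
    by an integrable density. *)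
Lemma standard_normal_sqr_bound (x : R) :
  (x ^+ 2 * normal_pdf 0 1 x <= 6 * normal_pdf 0 2 x)%R.
Proof.
have peak2 : (normal_peak 1 = 2 * normal_peak 2 :> R)%R.
  rewrite /normal_peak expr1n mul1r -mulrnAr sqrtrM ?sqr_ge0// sqrtr_sqr.
  by rewrite ger0_norm// invfM mulrA divff ?mul1r.
rewrite !normal_pdfE ?oner_eq0// peak2 /normal_fun !subr0.
set a := expR _; set b := expR _.
have a0 : (0 <= a)%R by exact: expR_ge0.
have -> : b = (a * expR (3 / 8 * x ^+ 2))%R.
  by rewrite /a /b -expRD; congr expR; field.
have := expR_ge1Dx (3 / 8 * x ^+ 2)%R.
set c := expR _ => c1.
have xc : (x ^+ 2 <= 3 * c)%R by have := sqr_ge0 x; nra.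
rewrite (_ : (6 * _ = 2 * normal_peak 2 * a * (3 * c))%R); last by ring.
rewrite [leLHS](_ : _ = 2 * normal_peak 2 * a * x ^+ 2)%R; last by ring.
by rewrite ler_wpM2l// !mulr_ge0// normal_peak_ge0.
Qed.

Lemma integrable_sqr_normal :
  (normal_prob 0 1).-integrable setT (fun x : R => (x ^+ 2)%:E).
Proof.
have msq : measurable_fun setT (fun x : R => (x ^+ 2)%:E).
  by apply/measurable_EFinP; exact: exprn_measurable.
have mabs : measurable_fun setT (fun x : R => `|(x ^+ 2)%:E|).
  exact: measurableT_comp.
apply/integrableP; split=> //; rewrite ge0_integral_normal_prob//.
apply: (@le_lt_trans _ _ (\int[mu]_x
    (6%:E * (normal_pdf 0 2 x)%:E))).
  apply: ge0_le_integral => //.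
  - move=> x _; rewrite mule_ge0// lee_fin normal_pdf_ge0//.
  - apply: emeasurable_funM.
      exact: mabs.
    by apply/measurable_EFinP; exact: measurable_normal_pdf.
  - apply: emeasurable_funM => //.
    by apply/measurable_EFinP; exact: measurable_normal_pdf.
  - move=> x _; rewrite /= ger0_norm ?sqr_ge0// -!EFinM lee_fin.
    exact: standard_normal_sqr_bound.
rewrite integralZl//; last exact: integrable_normal_pdf.
by rewrite integral_normal_pdf mule1 ltry.
Qed.

(** Domination by [1 + x^2]. *)
Lemma integrable_normal : (normal_prob 0 1).-integrable setT (@EFin R).
Proof.
have ig : (normal_prob 0 1).-integrable setT (fun x : R => (1 + x ^+ 2)%:E).
  rewrite (_ : (fun _ => _) = (cst 1%:E \+ (fun x : R => (x ^+ 2)%:E))) //.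
  apply: integrableD => //; last exact: integrable_sqr_normal.
  exact: finite_measure_integrable_cst.
apply: (le_integrable measurableT _ _ ig); first exact: EFin_measurable.
move=> x _ /=; rewrite lee_fin [leRHS]ger0_norm ?addr_ge0 ?sqr_ge0// -real_normK ?num_real//.
have := sqr_ge0 (`|x| - 1)%R; have := normr_ge0 x; nra.
Qed.

(** The density is even, so reflection exchanges the integrals of the positive and negative parts.
    It is applied to the negative part, which vanishes on the positive axis. *)
Lemma integral_normal0 : \int[normal_prob 0 1]_x (x : R)%:E = 0.
Proof.
rewrite integralE.
suff -> : \int[normal_prob 0 1]_x (@EFin R)^\+ x =
    \int[normal_prob 0 1]_x (@EFin R)^\- x.
  rewrite subee//; apply: (integrable_fin_num measurableT).
  exact/integrable_funeneg/integrable_normal.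
have contmax : continuous (fun x : R => Num.max (- x) 0)%R.
  under [X in continuous X]eq_fun do rewrite maxr_absE addr0 subr0 normrN.
  move=> x; apply: cvgMr_tmp; apply: cvgD; first exact: opp_continuous.
  exact: norm_continuous.
rewrite !ge0_integral_normal_prob//; last 2 first.
- by apply: measurable_funeneg; exact: EFin_measurable.
- by apply: measurable_funepos; exact: EFin_measurable.
transitivity (\int[mu]_x (Num.max x 0 * normal_pdf 0 1 x)%:E).
  by apply: eq_integral => x _; rewrite EFinM EFin_max ?funeposE ?funenegE.
transitivity (\int[mu]_x (Num.max (- x) 0 * normal_pdf 0 1 x)%:E); last first.
  by apply: eq_integral => x _; rewrite EFinM EFin_max ?funeposE ?funenegE.
rewrite [RHS]integral_halfline_opp.
- by apply: eq_integral => x _; rewrite normal_pdfN ?oner_eq0// opprK EFinM.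
- move=> x; apply: cvgM; first exact: contmax.
  by apply: continuous_normal_pdf; rewrite oner_eq0.
- by move=> x; rewrite mulr_ge0 ?normal_pdf_ge0// le_max lexx orbT.
- by move=> x x0; rewrite max_r ?mul0r// oppr_le0 ltW.
Qed.

End NormalMoments.

(** * Measurability *)

Section MeasurableMatrices.
Context {disp : measure_display} {T : measurableType disp} {R : realType}.

Definition measurable_mx m n (A : T -> 'M[R]_(m, n)) :=
  forall i j, measurable_fun setT (fun w => A w i j).

Lemma measurable_mx_cst m n (A : 'M[R]_(m, n)) : measurable_mx (fun=> A).
Proof. by move=> i j; exact: measurable_cst. Qed.

Lemma measurable_trmx m n (A : T -> 'M[R]_(m, n)) :
  measurable_mx A -> measurable_mx (fun w => (A w)^T).
Proof. by move=> mA i j; under eq_fun do rewrite mxE; exact: mA. Qed.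

Lemma measurable_mulmx m n k (A : T -> 'M[R]_(m, n)) (B : T -> 'M[R]_(n, k)) :
  measurable_mx A -> measurable_mx B -> measurable_mx (fun w => A w *m B w).
Proof.
move=> mA mB i j; under eq_fun do rewrite mxE.
by apply: measurable_sum => l; apply: measurable_funM.
Qed.

Lemma measurable_mxtrace n (A : T -> 'M[R]_n) :
  measurable_mx A -> measurable_fun setT (fun w => \tr (A w)).
Proof. by move=> mA; apply: measurable_sum => i; exact: mA. Qed.

Lemma measurable_frob2 m n (A : T -> 'M[R]_(m, n)) :
  measurable_mx A -> measurable_fun setT (fun w => frob2 (A w)).
Proof.
by move=> mA; apply/measurable_mxtrace/measurable_mulmx => //; exact: measurable_trmx.
Qed.

Lemma measurable_determinant n (A : T -> 'M[R]_n) :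
  measurable_mx A -> measurable_fun setT (fun w => \det (A w)).
Proof.
move=> mA; apply: measurable_sum => s; apply: measurable_funM => //.
by apply: measurable_prod => i _; exact: mA.
Qed.

(** Inversion is written as [x * (x^2)^(-1)] with a real power of a nonnegative number; at [x = 0]
    both sides are 0 by convention. *)
Lemma measurable_funV (f : T -> R) :
  measurable_fun setT f -> measurable_fun setT (fun w => (f w)^-1).
Proof.
move=> mf; rewrite (_ : (fun w => _) = fun w => f w * powR (f w ^+ 2) (-1)).
  apply: measurable_funM => //; apply: (measurableT_comp (measurable_powR _)).
  exact: measurable_funX.
apply/funext => w; rewrite powR_inv1 ?sqr_ge0// expr2 invfM.
by have [->|fw0] := eqVneq (f w) 0; [rewrite invr0 mul0r|rewrite mulrA divff ?mul1r].
Qed.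

(** Cramer's rule where the determinant is nonzero; on singular matrices [invmx] is the identity
    map. *)
Lemma measurable_invmx n (A : T -> 'M[R]_n) :
  measurable_mx A -> measurable_mx (fun w => invmx (A w)).
Proof.
move=> mA i j; rewrite (_ : (fun w => _) = fun w =>
    if \det (A w) == 0 then A w i j else (\det (A w))^-1 * (\adj (A w)) i j).
  have mdet := measurable_determinant mA.
  apply: measurable_fun_ifT => //; first exact: measurable_fun_eqr.
  apply: measurable_funM; first exact: measurable_funV.
  under eq_fun do rewrite mxE; apply: measurable_funM => //.
  apply: measurable_determinant => k l; under eq_fun do rewrite !mxE.
  exact: mA.
apply/funext => w; rewrite /invmx unitmxE unitfE.
by case: eqP => //= _; rewrite mxE.
Qed.

Lemma measurable_colproj m n (A : T -> 'M[R]_(m, n)) :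
  measurable_mx A -> measurable_mx (fun w => colproj (A w)).
Proof.
move=> mA; apply: measurable_mulmx; last exact: measurable_trmx.
apply: measurable_mulmx => //; apply: measurable_invmx.
by apply: measurable_mulmx => //; exact: measurable_trmx.
Qed.

Lemma measurable_angle p d (A : T -> 'M[R]_(p, d)) (G : 'M[R]_(p, d)) :
  measurable_mx A -> measurable_fun setT (fun w => angle (A w) G).
Proof.
move=> mA.
have mnum : measurable_fun setT (fun w => frob2 (colproj G *m A w)).
  by apply/measurable_frob2/measurable_mulmx => //; exact: measurable_mx_cst.
have mden : measurable_fun setT (fun w => frob2 ((1%:M - colproj G) *m A w)).
  by apply/measurable_frob2/measurable_mulmx => //; exact: measurable_mx_cst.
apply: measurable_fun_ifT => //; first exact: measurable_fun_eqr.
have matan : measurable_fun setT (@atan R).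
  by apply: continuous_measurable_fun; exact: continuous_atan.
have msqrt : measurable_fun setT (@Num.sqrt R).
  by apply: continuous_measurable_fun; exact: sqrt_continuous.
apply: (measurableT_comp matan); apply: (measurableT_comp msqrt).
by apply: measurable_funM => //; exact: measurable_funV.
Qed.

End MeasurableMatrices.

(** * Events generated by a family of random variables *)

Section GeneratedSigmaAlgebra.
Context {d d' : measure_display} {T : measurableType d} {S : measurableType d'}
  {I : Type} (X : I -> T -> S).

(** Equipping [T] with the sigma-algebra generated by this family turns membership in
    [sigma_family X] into measurability of functions, so the closure lemmas above apply. *)
Definition generators : set (set T) :=
  \bigcup_i preimage_set_system [set: T] (X i) measurable.

Lemma measurable_generator i :
  measurable_fun [set: g_sigma_algebraType generators]
    (X i : g_sigma_algebraType generators -> S).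
Proof.
move=> _ B mB; apply: sub_sigma_algebra.
by exists i => //; exists B.
Qed.

Lemma sigma_family_preimage d'' (S' : measurableType d'') (u : T -> S') B :
  measurable_fun [set: g_sigma_algebraType generators]
    (u : g_sigma_algebraType generators -> S') ->
  measurable B -> sigma_family X (u @^-1` B).
Proof. by move=> mu mB; have := mu measurableT _ mB; rewrite setTI. Qed.

End GeneratedSigmaAlgebra.

Lemma measurable_design (R : realType) (d d' : measure_display)
    (T : measurableType d) (Resp : measurableType d') (r : nat)
    (g : forall n : nat, n.-tuple Resp -> Resp -> 'cV[R]_r)
    (Y : nat -> T -> Resp) (n : nat) :
  (forall k : 'I_r, measurable_fun [set: (n.-tuple Resp * Resp)%type]
      (fun sy : (n.-tuple Resp * Resp)%type => g n sy.1 sy.2 k 0)) ->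
  (forall i, measurable_fun setT (Y i)) ->
  measurable_mx (fun w => design g Y n w).
Proof.
move=> g_meas mY i k; under eq_fun do rewrite /design !mxE.
have mpair : measurable_fun setT (fun w => ([tuple Y l w | l < n], Y i w)).
  apply: measurable_fun_pair; last exact: mY.
  apply/measurable_fun_tnthP => j; rewrite (_ : _ \o _ = Y j) //.
  by apply/funext => w /=; rewrite tnth_mktuple.
exact: (measurableT_comp (g_meas k) mpair).
Qed.

(** * The energy of the projected errors *)

Section ProjectedNoise.
Context {R : realType}.

(* The rank-deficient case, in which [colproj F] is a junk value, is sent to
   [0]. *)
Definition reg_proj n r (F : 'M[R]_(n, r)) : 'M[R]_n :=
  if \det (F^T *m F) == 0 then 0 else colproj F.

(** A symmetric idempotent turns the squared norm into a quadratic form. Each term separates a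
    design factor from an error factor, ready for independence. *)
Lemma reg_proj_frob2 n r p (F : 'M[R]_(n, r)) (E : 'M[R]_(n, p)) :
  frob2 (reg_proj F *m E) =
  \sum_j \sum_i \sum_k reg_proj F i k * (E i j * E k j).
Proof.
have -> : frob2 (reg_proj F *m E) = \tr (E^T *m reg_proj F *m E).
  rewrite /reg_proj; case: ifPn => [_|]; last first.
    by rewrite -unitfE -unitmxE => /colproj_frob2 ->.
  by rewrite mul0mx mulmx0 mul0mx /frob2 mulmx0.
apply: eq_bigr => j _; rewrite mxE.
under eq_bigr do rewrite mxE mulr_suml.
rewrite exchange_big/=; apply: eq_bigr => i _; apply: eq_bigr => k _.
by rewrite mxE; ring.
Qed.

Lemma reg_proj_entry_le n r (F : 'M[R]_(n, r)) i j : `|reg_proj F i j| <= r%:R.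
Proof.
rewrite /reg_proj; case: ifPn; first by rewrite mxE normr0.
by rewrite -unitfE -unitmxE => /colproj_entry_le.
Qed.

Lemma reg_proj_trace_le n r (F : 'M[R]_(n, r)) : \tr (reg_proj F) <= r%:R.
Proof.
rewrite /reg_proj; case: ifPn; first by rewrite mxtrace0.
by rewrite -unitfE -unitmxE => /colproj_trace ->.
Qed.

Lemma measurable_reg_proj d (T : measurableType d) n r (F : T -> 'M[R]_(n, r)) :
  measurable_mx F -> measurable_mx (fun w => reg_proj (F w)).
Proof.
move=> mF i j; rewrite (_ : (fun w => _) = fun w =>
    if \det ((F w)^T *m F w) == 0 then 0 else colproj (F w) i j).
  apply: measurable_fun_ifT => //; last exact: measurable_colproj.
  apply: measurable_fun_eqr => //; apply: measurable_determinant.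
  by apply: measurable_mulmx => //; exact: measurable_trmx.
by apply/funext => w; rewrite /reg_proj; case: ifP; rewrite ?mxE.
Qed.

Section Energy.
Local Open Scope ereal_scope.
Context d (T : measurableType d) (P : probability T R).

(** Only the diagonal terms have nonzero mean, so each of the [p] columns contributes [s2] times the
    mean trace of the projection, which is at most [r]. *)
Lemma reg_proj_noise_energy n r p (F : T -> 'M[R]_(n, r))
    (e : T -> 'M[R]_(n, p)) (s2 : R) :
  measurable_mx F -> (0 <= s2)%R ->
  (forall i k j, has_mean P (fun w => e w i j * e w k j)%R (s2 *+ (i == k))) ->
  (forall a b i k j (A B : set R), measurable A -> measurable B ->
    P ((fun w => reg_proj (F w) a b) @^-1` A `&`
       (fun w => e w i j * e w k j)%R @^-1` B) =
    P ((fun w => reg_proj (F w) a b) @^-1` A) *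
    P ((fun w => e w i j * e w k j)%R @^-1` B)) ->
  exists2 m, has_mean P (fun w => frob2 (reg_proj (F w) *m e w)) m &
    (m <= p%:R * (r%:R * s2))%R.
Proof.
move=> mF s20 Ee indep.
have iU a b : P.-integrable setT (EFin \o (fun w => reg_proj (F w) a b)).
  apply: (@le_integrable _ _ _ _ _ measurableT _ (cst r%:R%:E)).
  - exact/measurable_EFinP/measurable_reg_proj.
  - by move=> w _; rewrite /= lee_fin [leRHS]ger0_norm// reg_proj_entry_le.
  - exact: finite_measure_integrable_cst.
pose u a b := fine (\int[P]_w (reg_proj (F w) a b)%:E).
have Eu a b : has_mean P (fun w => reg_proj (F w) a b) (u a b).
  exact: integrable_has_mean.
exists (\sum_(j < p) \sum_i \sum_k u i k * (s2 *+ (i == k)))%R.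
  under eq_fun do rewrite reg_proj_frob2.
  do 3 (apply: has_mean_sum => ?).
  by apply: has_mean_indepM => //; exact: indep.
rewrite sumr_const card_ord -[leLHS]mulr_natl ler_wpM2l//.
have tru : (\sum_i u i i <= r%:R)%R.
  apply: (@has_mean_le _ _ _ P (fun w => \tr (reg_proj (F w)))).
    exact: has_mean_sum.
  by move=> w; exact: reg_proj_trace_le.
apply: le_trans (ler_wpM2r s20 tru); rewrite mulr_suml; apply: ler_sum => i _.
rewrite (bigD1 i)//= eqxx mulr1n big1 ?addr0// => k; rewrite eq_sym => /negbTE ->.
by rewrite mulr0n mulr0.
Qed.

End Energy.

End ProjectedNoise.

(** * Almost sure events and transfer to the normal law *)

Section Probability.
Context d (T : measurableType d) (R : realType) (P : probability T R).

Lemma ae_exists (Q : T -> Prop) : {ae P, forall w, Q w} -> exists w, Q w.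
Proof.
move=> [A [mA PA0 QA]]; apply: contrapT => nQ.
have AT : A = setT.
  by apply/seteqP; split=> // w _; apply: QA => Qw; apply: nQ; exists w.
by move: PA0; rewrite AT probability_setT => /eqP; rewrite eqe oner_eq0.
Qed.

Lemma ae_eventually_probC (E : nat -> set T) (a : R) :
  (forall n, measurable (E n)) -> {ae P, forall w, \forall n \near \oo, E n w} ->
  0 < a -> \forall n \near \oo, (P (~` E n) <= a%:E)%E.
Proof.
move=> mE [A [mA PA0 QA]] a0.
have mEC n : measurable (~` E n) by exact: measurableC.
have lim0 : P (lim_sup_set (fun n => ~` E n)) = 0%E.
  apply/eqP; rewrite eq_le measure_ge0 andbT -PA0.
  apply: le_measure; rewrite ?inE//.
    by apply: bigcap_measurable => // k _; exact: bigcup_measurable.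
  move=> w limw; apply: QA => -[N _ NE].
  by have [k /= Nk] := limw N I; apply; exact: NE.
have H : P (\bigcup_(k >= n) ~` E k) @[n --> \oo] --> 0%E.
  rewrite -lim0; apply: lim_sup_set_cvg => //.
  apply: le_lt_trans (ltry 1); apply: probability_le1.
  exact: bigcup_measurable.
have : \forall n \near \oo, (P (\bigcup_(k >= n) ~` E k) < a%:E)%E.
  apply: (H [set x | (x < a%:E)%E]); apply: open_nbhs_nbhs.
  split; first exact: open_ereal_lt_ereal.
  by rewrite /= lte_fin.
apply: filterS => n /ltW; apply: le_trans; apply: le_measure; rewrite ?inE//.
  exact: bigcup_measurable.
by move=> w Ew; exists n => /=.
Qed.

(* [normal_prob] lives on [measurableTypeR R], whose display differs from the
   one of the canonical measurable structure on [R]. *)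
Lemma has_mean_normal (X : {RV P >-> measurableTypeR R}) (f : R -> R) :
  (forall B, measurable B -> distribution P X B = normal_prob 0 1 B) ->
  (normal_prob 0 1).-integrable setT (EFin \o f) ->
  has_mean P (f \o X) (fine (\int[normal_prob 0 1]_x (f x)%:E)).
Proof.
move=> XN intf.
have mf := measurable_int _ intf.
have intX : P.-integrable setT ((EFin \o f) \o X).
  apply/integrableP; split; first by apply: (measurableT_comp mf (measurable_funP X)).
  rewrite -(ge0_integral_distribution X (f := abse \o (EFin \o f)))//; last 2 first.
  - exact: measurableT_comp.
  - by move=> y; exact: abse_ge0.
  rewrite (eq_measure_integral (normal_prob 0 1)) => [|A mA _]; last exact: XN.
  by have /integrableP[] := intf.
split=> //.
rewrite fineK ?(integrable_fin_num measurableT)//.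
apply: (etrans (esym (integral_distribution mf intX))).
by apply: eq_measure_integral => A mA _; exact: XN.
Qed.

End Probability.

(** * Moments of the errors and their independence from the design *)

Section NormalErrors.
Context (R : realType) (disp : measure_display) (T : measurableType disp)
  (P : probability T R) (p : nat) (eps : nat -> 'I_p -> {RV P >-> R}).
Hypothesis eps_indep : mutually_independent P
    (fun ij : nat * 'I_p => eps ij.1 ij.2 : T -> R).
Hypothesis eps_normal : forall (i : nat) (j : 'I_p) (B : set R), measurable B ->
    distribution P (eps i j) B = normal_prob 0 1 B.

(** The second moment stays symbolic: its finiteness is what the bounds rely on. *)
Let s2 := fine (\int[normal_prob 0 1]_x ((x : R) ^+ 2)%:E).

(** Errors of different observations are independent with mean zero; for [i = k] the product is a
    square. *)
Lemma has_mean_error2 i k j :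
  has_mean P (fun w => eps i j w * eps k j w) (s2 *+ (i == k)).
Proof.
have meps l : @measurable_fun _ _ T (measurableTypeR R) setT (eps l j).
  exact: (measurable_funP (eps l j)).
pose X l : {RV P >-> measurableTypeR R} :=
  @mfun_Sub _ _ T (measurableTypeR R) _ (mem_set (meps l)).
have XN l (B : set (measurableTypeR R)) : measurable B ->
    distribution P (X l) B = normal_prob 0 1 B.
  exact: (eps_normal l j).
have [->|ik] := eqVneq i k.
  rewrite mulr1n; have := has_mean_normal (XN k) (@integrable_sqr_normal R).
  by congr (has_mean P _ _); apply/funext => w /=; rewrite expr2.
have mean0 l : has_mean P (eps l j) 0.
  have := has_mean_normal (XN l) (@integrable_normal R).
  by rewrite integral_normal0.
rewrite mulr0n -[0](mulr0 0); apply: has_mean_indepM => // A B mA mB.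
have := @eps_indep [:: (i, j); (k, j)]
  (fun l => if l == (i, j) then A else B).
rewrite !big_cons !big_nil/= eqxx (_ : (k, j) == (i, j) = false); last first.
  by rewrite xpair_eqE eq_sym (negbTE ik).
rewrite setIT mule1; apply; first by rewrite inE xpair_eqE (negbTE ik).
by move=> l; case: ifP.
Qed.

Context (dispY : measure_display) (Resp : measurableType dispY) (r : nat)
  (Y : nat -> {RV P >-> Resp})
  (g : forall n : nat, n.-tuple Resp -> Resp -> 'cV[R]_r).
Hypothesis g_meas : forall (n : nat) (k : 'I_r),
    measurable_fun [set: (n.-tuple Resp * Resp)%type]
      (fun sy : (n.-tuple Resp * Resp)%type => g sy.1 sy.2 k 0).
Hypothesis eps_Y_indep : independent_families P
    (fun ij : nat * 'I_p => eps ij.1 ij.2 : T -> R)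
    (fun i : nat => Y i : T -> Resp).

Lemma projected_error_energy n :
  exists2 m, has_mean P (fun w => frob2 (reg_proj (design g Y n w) *m
      \matrix_(i < n) (error (fun i j => eps i j : T -> R) i w)^T)) m &
    m <= p%:R * (r%:R * s2).
Proof.
have mY i : measurable_fun setT (Y i : T -> Resp) by exact: measurable_funP.
apply: reg_proj_noise_energy.
- by apply: measurable_design => // k; exact: g_meas.
- apply: fine_ge0; apply: integral_ge0 => x _; rewrite lee_fin; exact: sqr_ge0.
- move=> i k j; have := has_mean_error2 i k j.
  by congr (has_mean P _ _); apply/funext => w; rewrite !mxE.
(* The projection is a measurable function of the responses, the product one of the errors;
   independence of the two generated sigma-algebras concludes. *)
move=> a b i k j A B mA mB; rewrite setIC muleC; apply: eps_Y_indep.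
  apply: (sigma_family_preimage _ mB).
  rewrite (_ : (fun w => _) = fun w => eps i j w * eps k j w); last first.
    by apply/funext => w; rewrite !mxE.
  have meps := measurable_generator (X := fun ij : nat * 'I_p => eps ij.1 ij.2 : T -> R).
  by apply: measurable_funM; [exact: (meps (nat_of_ord i, j))|
    exact: (meps (nat_of_ord k, j))].
apply: (sigma_family_preimage _ mA).
apply: measurable_reg_proj.
apply: measurable_design => [l|l]; first exact: g_meas.
exact: (measurable_generator (X := fun i => Y i : T -> Resp)).
Qed.

End NormalErrors.

(** * The confidence bound *)

Theorem theorem4p3 (R : realType)
  (disp : measure_display) (T : measurableType disp) (P : probability T R)
  (dispY : measure_display) (Resp : measurableType dispY)
  (p d r : nat) (d_gt0 : (0 < d)%N) (ltdp : (d < p)%N) (ledr : (d <= r)%N)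
  (mu : 'cV[R]_p) (Gamma : 'M[R]_(p, d)) (beta : 'M[R]_(d, r)) (sigma : R)
  (Gamma_orth : Gamma^T *m Gamma = 1%:M)
  (Y : nat -> {RV P >-> Resp})
  (Y_indep : mutually_independent P (fun i : nat => Y i : T -> Resp))
  (Y_ident : forall (i : nat) (B : set Resp), measurable B ->
    distribution P (Y i) B = distribution P (Y 0%N) B)
  (g : forall n : nat, n.-tuple Resp -> Resp -> 'cV[R]_r)
  (g_meas : forall (n : nat) (k : 'I_r),
    measurable_fun [set: (n.-tuple Resp * Resp)%type]
      (fun sy : (n.-tuple Resp * Resp)%type => g n sy.1 sy.2 k 0))
  (f_centered : forall (n : nat) (w : T), \sum_(i < n) regressor g Y w i = 0)
  (F_full_rank : {ae P, forall w : T,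
    \forall n \near \oo, \rank (design g Y n w) = r})
  (eps : nat -> 'I_p -> {RV P >-> R})
  (eps_indep : mutually_independent P
    (fun ij : nat * 'I_p => eps ij.1 ij.2 : T -> R))
  (eps_normal : forall (i : nat) (j : 'I_p) (B : set R), measurable B ->
    distribution P (eps i j) B = normal_prob 0 1 B)
  (eps_Y_indep : independent_families P
    (fun ij : nat * 'I_p => eps ij.1 ij.2 : T -> R)
    (fun i : nat => Y i : T -> Resp))
  (Phi : 'M[R]_d)
  (Phi_lim : {ae P, forall w : T,
    (fun n : nat => n%:R^-1 *:
       (beta *m ((design g Y n w)^T *m design g Y n w) *m beta^T)) @ \oo
      --> Phi})
  (Phi_distinct : distinct_eigenvalues Phi)
  (Phi_neq0 : d = 1%N -> Phi != 0)
  (Gammahat : forall n : nat, T -> 'M[R]_(p, d))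
  (Gammahat_meas : forall (n : nat) (i : 'I_p) (j : 'I_d),
    measurable_fun [set: T] (fun w : T => Gammahat n w i j))
  (Gammahat_pfc : forall (n : nat) (w : T), \rank (design g Y n w) = r ->
    is_pfc (design g Y n w)
      (fun i : 'I_n => observation mu Gamma beta sigma
         (regressor g Y w i) (error (fun i j => eps i j : T -> R) i w))
      (Gammahat n w)) :
  exists Thetastar : R -> nat -> R,
    forall alpha : R, 0 < alpha < 1 ->
      (forall n : nat, (0 < n)%N ->
        (P [set w | (Thetastar alpha n <= angle (Gammahat n w) Gamma)%R]
           <= alpha%:E)%E) /\
      (Thetastar alpha : nat -> R^o) =O_\oo
        (fun n : nat => (Num.sqrt n%:R)^-1 : R^o).
Proof.
set F := fun n w => design g Y n w.
have mY i : measurable_fun setT (Y i : T -> Resp) by exact: measurable_funP.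
have mF n : measurable_mx (F n) by apply: measurable_design => // k; exact: g_meas.
have Phi0 : Phi != 0.
  have [d1|] := ltnP 1 d; first exact: distinct_eigenvalues_neq0.
  by move=> d1; apply: Phi_neq0; apply/eqP; rewrite eqn_leq d1 d_gt0.
have gramE n w : beta *m ((F n w)^T *m F n w) *m beta^T =
    (F n w *m beta^T)^T *m (F n w *m beta^T).
  by rewrite trmx_mul trmxK !mulmxA.
(* [Phi] is deterministic, so a single sample point at which the limit holds is enough. *)
have trPhi : 0 < \tr Phi.
  have [w] := ae_exists Phi_lim.
  under eq_fun do rewrite gramE.
  move=> /(gram_limit_trace_gt0 (c := fun n => n%:R^-1)); apply=> //.
(* Halving leaves a margin: the normalized signal energy eventually exceeds [tau]. *)
set tau := \tr Phi / 2.
have tau0 : 0 < tau by rewrite divr_gt0.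
(* The good event: full rank and signal energy at least [n * tau]. Almost every sample point
   eventually stays in it. *)
pose E n := [set w | (\det ((F n w)^T *m F n w) != 0) &&
  (n%:R * tau <= \tr (beta *m ((F n w)^T *m F n w) *m beta^T))].
have mE n : measurable (E n).
  have mgram : measurable_mx (fun w => (F n w)^T *m F n w).
    by apply: measurable_mulmx => //; exact: measurable_trmx.
  rewrite -[E n]setTI; apply: (measurable_and _ _ measurableT (Y := [set true])) => //.
    apply: measurable_neg; apply: measurable_fun_eqr => //.
    exact: measurable_determinant.
  apply: measurable_fun_ler => //; apply: measurable_mxtrace.
  apply: measurable_mulmx; last exact: measurable_mx_cst.
  by apply: measurable_mulmx => //; exact: measurable_mx_cst.
have aeE : {ae P, forall w, \forall n \near \oo, E n w}.
  apply: filterS2 F_full_rank Phi_lim => w rkw limw.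
  have trlim := cvg_mxtrace limw.
  have tau_lt : tau < \tr Phi by rewrite /tau; lra.
  have tau_near : \forall n \near \oo, tau <
      \tr (n%:R^-1 *: (beta *m ((F n w)^T *m F n w) *m beta^T)).
    by apply: (cvgr_gt _ trlim).
  near=> n; apply/andP; split.
    rewrite -unitfE -unitmxE gram_unitmx; apply/eqP.
    by near: n; exact: rkw.
  have n0 : 0 < n%:R :> R by rewrite ltr0n; near: n; exact: nbhs_infty_gt.
  rewrite mulrC -ler_pdivlMr// mulrC -mxtraceZ ltW//.
  by near: n; exact: tau_near.
set s2 := fine (\int[normal_prob 0 1]_x ((x : R) ^+ 2)%:E).
have s20 : 0 <= s2.
  by apply: fine_ge0; apply: integral_ge0 => x _; rewrite lee_fin sqr_ge0.
suff tight alpha : exists Th : nat -> R, 0 < alpha < 1 ->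
    (forall n : nat, (0 < n)%N ->
        (P [set w | (Th n <= angle (Gammahat n w) Gamma)%R] <= alpha%:E)%E) /\
      (Th : nat -> R^o) =O_\oo (fun n : nat => (Num.sqrt n%:R)^-1 : R^o).
  have [Th HTh] := choice tight; exists Th => alpha; exact: HTh.
have [alpha01|nalpha] := boolP (0 < alpha < 1); last by exists (fun=> 0).
have /andP[alpha0 _] := alpha01.
(* Chosen so that Markov's inequality gives the noise event probability at most [alpha / 2]; the
   added 1 keeps [K] positive. *)
pose K := 2 * (p%:R * (r%:R * s2) + 1) / alpha.
have m0 : 0 <= p%:R * (r%:R * s2) by rewrite !mulr_ge0.
have K0 : 0 < K by rewrite !mulr_gt0 ?invr_gt0// ltr_wpDl.
have [N1 _ HN1] := ae_eventually_probC mE aeE (divr_gt0 alpha0 (ltr0Sn R 1)).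
(* The noise threshold of [pfc_angle_le], passed by [n * tau] from [N2] on. *)
pose b := 8 * p%:R * (1 + d%:R) * (sigma ^+ 2 * K).
have [N2 HN2] : exists N2 : nat, forall n, (N2 <= n)%N -> b <= n%:R * tau.
  exists (Num.truncn (b / tau)).+1 => n nN.
  rewrite -ler_pdivrMr// ltW// (lt_le_trans (truncnS_gt _))// ler_nat//.
pose N := maxn N1 N2.
(* The added 1 puts the threshold strictly above the deterministic bound, as the event to be
   excluded is a weak inequality. *)
pose C := Num.sqrt (4 * p%:R * d%:R * (sigma ^+ 2 * K) / tau) + 1.
(* For [n < N] the value exceeds every angle, so the event is empty; these finitely many terms do
   not affect the order. *)
pose Th n := if (N <= n)%N then C / Num.sqrt n%:R else pi / 2 + 1.
have C0 : 0 < C by rewrite ltr_wpDl ?sqrtr_ge0.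
exists Th => _; split; last first.
  apply/eqO_exP; exists C => //; near=> n.
  have Nn : (N <= n)%N by near: n; exact: nbhs_infty_ge.
  by rewrite /Th Nn normrM (gtr0_norm C0).
move=> n n0; rewrite /Th; case: ifPn => Nn; last first.
  rewrite (_ : [set w | _] = set0) ?measure0 ?lee_fin ?(ltW alpha0)//.
  apply/seteqP; split=> // w /= H.
  have /andP[_ H'] := angle_itv (Gammahat n w) Gamma.
  by have := le_trans H H'; rewrite gerDl ler10.
have [m meanW mle] :=
  projected_error_energy eps_indep eps_normal g_meas eps_Y_indep n.
set W := (fun w => frob2 _) in meanW.
have PW : (P [set w | K <= W w]%R <= (alpha / 2)%:E)%E.
  apply: (le_trans (has_mean_markov meanW _ K0)) => [w|]; first exact: frob2_ge0.
  rewrite lee_fin ler_pdivrMr// (le_trans mle)// /K.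
  rewrite (_ : _ / 2 * _ = p%:R * (r%:R * s2) + 1) ?lerDl//; field.
  by rewrite gt_eqF.
have mW : measurable [set w | K <= W w].
  have mWf : measurable_fun setT W by exact/measurable_EFinP/(measurable_int _ meanW.1).
  rewrite -[X in measurable X]setTI.
  exact: (measurable_fun_ler (measurable_cst K) mWf measurableT (Y := [set true])).
have mA : measurable [set w | C / Num.sqrt n%:R <= angle (Gammahat n w) Gamma].
  have mang : measurable_fun setT (fun w => angle (Gammahat n w) Gamma).
    by apply: measurable_angle => i j; exact: Gammahat_meas.
  rewrite -[X in measurable X]setTI.
  exact: (measurable_fun_ler (measurable_cst _) mang measurableT (Y := [set true])).
(* On the good event with noise below [K], the deterministic bound contradicts a large angle. Each
   of the two exceptional events costs [alpha / 2]. *)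
apply: (@le_trans _ _ (P (~` E n `|` [set w | K <= W w]))).
  apply: le_measure; rewrite ?inE//; first by apply: measurableU => //; exact: measurableC.
  move=> w /= Cang; apply: contrapT => /not_orP[/contrapT /andP[detn taun] /negP].
  rewrite -ltNge => /ltW WK.
  have Funit : (F n w)^T *m F n w \in unitmx by rewrite unitmxE unitfE.
  have top := Gammahat_pfc _ _ (eqP (etrans (esym (gram_unitmx (F n w))) Funit)).
  rewrite /is_pfc in top.
  have ME := fitted_observation mu Gamma beta sigma
     (fun i => error (fun i j => eps i j : T -> R) i w) (f_centered n w) Funit.
  have regE : reg_proj (F n w) = colproj (F n w).
    by rewrite /reg_proj (negbTE detn).
  have nR : 0 < n%:R :> R by rewrite ltr0n.
  have := pfc_angle_le Gamma_orth d_gt0 ltdp ME top (K := K) (tau := n%:R * tau).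
  rewrite -regE => /(_ WK).
  have nN2 : (N2 <= n)%N by rewrite (leq_trans _ Nn)// leq_maxr.
  move=> /(_ (HN2 _ nN2) (mulr_gt0 nR tau0) taun) angle_le.
  have := le_trans Cang angle_le; apply/negP; rewrite -ltNge.
  rewrite (_ : _ / (n%:R * tau) =
      4 * p%:R * d%:R * (sigma ^+ 2 * K) / tau / n%:R); last first.
    by field; rewrite !gt_eqF.
  rewrite sqrtrM; last first.
    apply: divr_ge0 (ltW tau0); apply: mulr_ge0; first by rewrite !mulr_ge0.
    exact: mulr_ge0 (sqr_ge0 _) (ltW K0).
  rewrite sqrtrV// ltr_pM2r ?invr_gt0 ?sqrtr_gt0//.
  by rewrite /C ltrDl.
apply: (le_trans (measureU2 _ _ _)) => //; first exact: measurableC.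
rewrite [X in (_ <= X%:E)%E](splitr alpha) EFinD leeD//.
by apply: HN1; rewrite /= (leq_trans _ Nn)// leq_maxl.
Unshelve. all: end_near.
Qed.
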